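(* Let $(W,S)$ be a Coxeter group with $S$ finite. Suppose $x,y\in W$ and $y=s_1s_2\cdots s_k$ ($s_j\in S$) is a reduced expression. Suppose $1\le i_1<i_2<\cdots<i_p\le k$ are such that for all $n=1,2,\dots,p$, $$x s_1 s_2\cdots\widehat{s_{i_1}}\cdots\widehat{s_{i_{n-1}}}\cdots s_{i_n-1}\,s_{i_n}\;<\;x s_1 s_2\cdots\widehat{s_{i_1}}\cdots\widehat{s_{i_{n-1}}}\cdots s_{i_n-1}$$ in the Bruhat order, where on both sides exactly the letters $s_{i_1},\dots,s_{i_{n-1}}$ are omitted. Then there exists an intersecting set $\mathfrak{Q}$ with $|\mathfrak{Q}|=p$.
   Context: Let $m_{st}$ be the order of $st$ ($s,t\in S$). $V$ is the real vector space with basis $\{\alpha_s\mid s\in S\}$ and symmetric bilinear form $\operatorname{B}(\alpha_s,\alpha_t)=-\cos(\pi/m_{st})$ if $m_{st}\neq\infty$ and $-1$ if $m_{st}=\infty$. $W$ acts on $V$ by $sv=v-2\operatorname{B}(\alpha_s,v)\alpha_s$ and on the dual $V^*$ by $\langle wf,wv\rangle=\langle f,v\rangle$. Let $\Phi=\{w\alpha_s\mid w\in W,s\in S\}$ and let $\Phi^+$ be the set of roots that are nonnegative combinations of the $\alpha_s$. For $\alpha\in\Phi$ let $H_\alpha=\{f\in V^*\mid\langle f,\alpha\rangle=0\}$, and let $\mathfrak{P}=\{H_\alpha\mid\alpha\in\Phi^+\}$. Let $C=\{f\in V^*\mid\langle f,\alpha_s\rangle>0\ \forall s\in S\}$, let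 $\overline{C}$ be its closure, let $U=\bigcup_{w\in W}w\overline{C}$ be the Tits cone and $U^\circ$ its interior in $V^*$. A subset $\mathfrak{Q}\subset\mathfrak{P}$ is called intersecting if $H_1\cap H_2\cap U^\circ\neq\varnothing$ for any $H_1,H_2\in\mathfrak{Q}$ (in particular $\varnothing$ is intersecting). *)

(* Defs.v *)
From HB Require Import structures.
From mathcomp Require Import all_boot all_order all_algebra.
From mathcomp Require Import all_classical all_reals all_analysis.
From mathcomp Require Import ring.
From Stdlib Require Import Relation_Operators.

Set Implicit Arguments.
Unset Strict Implicit.
Unset Printing Implicit Defensive.

Import Order.TTheory GRing.Theory Num.Theory.
Import numFieldNormedType.Exports.

Local Open Scope group_scope.

(* The least n with P n; the junk value 0 if there is none. *)
Definition least (P : pred nat) : nat :=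
  if pselect (exists n, P n) is left exP then ex_minn exP else 0%N.

(* An element of infinite order gets order 0. *)
Definition elt_order (G : groupType) (x : G) : nat :=
  least [pred n | (0 < n)%N && (x ^+ n == 1)].

(* The generating set S is given by an injective enumeration s : 'I_r -> W.
   W is presented by S subject to the relations (st)^m_st = 1 for m_st finite:
   S generates W, and every map from S to a group G which respects the
   relations extends to W.  The relations with m_st infinite, i.e. with
   elt_order 0, read 1 = 1. *)
Record coxeter_system (W : groupType) (r : nat) (s : 'I_r -> W) : Prop :=
  CoxeterSystem {
    cox_inj : injective s;
    cox_order2 : forall i, elt_order (s i) = 2;
    cox_gen : forall w, exists u : seq 'I_r, w = \prod_(i <- u) s i;
    cox_univ : forall (G : groupType) (f : 'I_r -> G),
      (forall i j, (f i * f j) ^+ elt_order (s i * s j) = 1) ->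
      exists phi : {multiplicative W -> G}, forall i, phi (s i) = f i
  }.

Section Bruhat.
Variables (W : groupType) (r : nat) (s : 'I_r -> W).

Definition cox_length (w : W) : nat :=
  least [pred k | [exists u : k.-tuple 'I_r, w == \prod_(i <- u) s i]].

Definition is_reflection (t : W) : Prop :=
  exists w i, t = w * s i * w^-1.

Definition bruhat_step (u v : W) : Prop :=
  exists2 t, is_reflection t & v = u * t /\ (cox_length u < cox_length v)%N.

Definition bruhat_lt : W -> W -> Prop := clos_trans W bruhat_step.

Definition reduced_expression k (u : 'I_k -> 'I_r) (w : W) : Prop :=
  w = \prod_(j < k) s (u j) /\ k = cox_length w.

End Bruhat.

(* The group GL_r(R), for arbitrary r *)
Section GL.
Variables (R : realType) (r : nat).

Definition glmx := {A : 'M[R]_r | A \in unitmx}.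
HB.instance Definition _ := Choice.on glmx.

Definition glmx_mul (A B : glmx) : glmx :=
  exist _ (val A *m val B)%R
    (etrans (unitmx_mul _ _) (introT andP (conj (valP A) (valP B)))).
Definition glmx_one : glmx := exist _ 1%:M%R (unitmx1 _ _).
Definition glmx_inv (A : glmx) : glmx :=
  exist _ (invmx (val A)) (etrans (unitmx_inv _) (valP A)).

Lemma glmx_mulA : associative glmx_mul.
Proof. by move=> A B C; apply: val_inj; rewrite /= mulmxA. Qed.
Lemma glmx_mul1 : left_id glmx_one glmx_mul.
Proof. by move=> A; apply: val_inj; rewrite /= mul1mx. Qed.
Lemma glmx_mulr1 : right_id glmx_one glmx_mul.
Proof. by move=> A; apply: val_inj; rewrite /= mulmx1. Qed.
Lemma glmx_mulV : left_inverse glmx_one glmx_inv glmx_mul.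
Proof. by move=> A; apply: val_inj; rewrite /= mulVmx // (valP A). Qed.
Lemma glmx_mulVr : right_inverse glmx_one glmx_inv glmx_mul.
Proof. by move=> A; apply: val_inj; rewrite /= mulmxV // (valP A). Qed.

HB.instance Definition _ := isGroup.Build glmx
  glmx_mulA glmx_mul1 glmx_mulr1 glmx_mulV glmx_mulVr.

End GL.

Local Open Scope ring_scope.

(* V is 'cV[R]_r, with simple roots the standard basis; the dual V^* is
   'rV[R]_r, in the dual basis, with its usual topology. *)
Section Geometric.
Variables (R : realType) (W : groupType) (r : nat) (s : 'I_r -> W).

Definition simple_root (i : 'I_r) : 'cV[R]_r := delta_mx i 0.

Definition gram : 'M[R]_r := \matrix_(i, j)
  let m := elt_order (s i * s j)%g in
  if m == 0%N then -1 else - cos (pi / m%:R).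

Definition cox_form (u v : 'cV[R]_r) : R := (u^T *m gram *m v) 0 0.

Definition refl_mx (i : 'I_r) : 'M[R]_r :=
  1%:M - 2 *: (simple_root i *m (simple_root i)^T *m gram).

Lemma refl_mxE i v :
  refl_mx i *m v = v - (2 * cox_form (simple_root i) v) *: simple_root i.
Proof.
rewrite mulmxBl mul1mx -scalemxAl -!mulmxA -scalerA; congr (_ - _ *: _).
by rewrite [X in _ *m X]mx11_scalar mul_mx_scalar /cox_form -mulmxA.
Qed.

Lemma cox_form_rootE i j :
  cox_form (simple_root i) (simple_root j) = gram i j.
Proof.
rewrite /cox_form /simple_root trmx_delta -rowE -colE.
by rewrite mxE mxE.
Qed.

Lemma cox_formD u v w : cox_form u (v + w) = cox_form u v + cox_form u w.
Proof. by rewrite /cox_form mulmxDr mxE. Qed.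

Lemma cox_formZ u a v : cox_form u (a *: v) = a * cox_form u v.
Proof. by rewrite /cox_form -scalemxAr mxE. Qed.

Lemma leastP (P : pred nat) : (exists n, P n) ->
  P (least P) /\ forall k, P k -> (least P <= k)%N.
Proof. by rewrite /least; case: pselect => // exP _; case: ex_minnP. Qed.

Lemma least_gt0 (P : pred nat) : (0 < least P)%N ->
  P (least P) /\ forall k, P k -> (least P <= k)%N.
Proof.
by rewrite /least; case: pselect => // exP; case: ex_minnP.
Qed.

Hypothesis cox : coxeter_system s.

Lemma cox_sqr i : (s i * s i = 1)%g.
Proof.
have := @least_gt0 [pred n | (0 < n)%N && ((s i ^+ n)%g == 1%g)].
rewrite -/(elt_order (s i)) (cox_order2 cox) => /(_ isT)[/= /eqP + _].
by rewrite expgS expg1.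
Qed.

Lemma cox_neq1 i : (s i != 1)%g.
Proof.
apply/eqP => si1.
have := @least_gt0 [pred n | (0 < n)%N && ((s i ^+ n)%g == 1%g)].
rewrite -/(elt_order (s i)) (cox_order2 cox) => /(_ isT)[_ /(_ 1%N)].
by rewrite /= expg1 si1 eqxx => /(_ isT).
Qed.

Lemma elt_order1 (G : groupType) : elt_order (1%g : G) = 1%N.
Proof.
have [|/= h1 h2] := @leastP [pred n | (0 < n)%N && ((1%g : G) ^+ n == 1)%g].
  by exists 1%N; rewrite /= expg1 eqxx.
rewrite -/(elt_order (1%g : G)) in h1 h2.
case/andP: h1 => h1 _; apply/eqP; rewrite eqn_leq h1 andbT; apply: h2.
by rewrite /= expg1 eqxx.
Qed.

Lemma cox_inv i : ((s i)^-1 = s i)%g.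
Proof. by rewrite -[LHS]mulg1 -(cox_sqr i) mulKg. Qed.

Lemma elt_order_sym i j : elt_order (s i * s j)%g = elt_order (s j * s i)%g.
Proof.
rewrite /elt_order; congr least; apply/funext => n /=; congr (_ && _).
have -> : (s j * s i = (s i * s j)^-1)%g by rewrite invgM !cox_inv.
by rewrite expVgn invg_eq1.
Qed.

Lemma gram_diag i : gram i i = 1.
Proof.
by rewrite mxE cox_sqr elt_order1 /= divr1 cospi opprK.
Qed.

Lemma gram_sym i j : gram i j = gram j i.
Proof. by rewrite !mxE elt_order_sym. Qed.

Lemma refl_mx_involutive i (v : 'cV[R]_r) : refl_mx i *m (refl_mx i *m v) = v.
Proof.
rewrite !refl_mxE cox_formD -scaleNr cox_formZ cox_form_rootE gram_diag.
by apply/matrixP => k l; rewrite !mxE; ring.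
Qed.

Lemma refl_mx_sqr i : refl_mx i *m refl_mx i = 1%:M.
Proof.
apply/matrixP => k l.
have := congr1 (fun v : 'cV_r => v k 0) (refl_mx_involutive i (delta_mx l 0)).
by rewrite /= mulmxA -colE !mxE eqxx andbT.
Qed.

Lemma refl_mx_unit i : refl_mx i \in unitmx.
Proof. by case/mulmx1_unit: (refl_mx_sqr i). Qed.

Definition refl_gl i : glmx R r := exist _ (refl_mx i) (refl_mx_unit i).

Lemma elt_order_gt0 (G : groupType) (x : G) : (0 < elt_order x)%N ->
  (x ^+ elt_order x = 1)%g.
Proof. by move=> /least_gt0[/andP[_ /eqP]]. Qed.

Lemma elt_order_neq1 i j : i != j -> elt_order (s i * s j)%g != 1%N.
Proof.
move=> ij; apply/eqP => m1; have := @elt_order_gt0 _ (s i * s j)%g.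
rewrite m1 expg1 => /(_ isT) sij.
have : s i = s j by rewrite -[s i](mulgK (s j)) sij mul1g cox_inv.
by move/(cox_inj cox)/eqP; rewrite (negbTE ij).
Qed.

Lemma refl_gl_rel i j :
  ((refl_gl i * refl_gl j) ^+ elt_order (s i * s j) = 1)%g.
Proof.
set x := (refl_gl i * refl_gl j)%g; set m := elt_order _.
have [m0|m0] := posnP m; first by rewrite m0 expg0.
have [ij|ij] := eqVneq i j.
  rewrite /x /m ij cox_sqr elt_order1 expg1; apply: val_inj => /=.
  exact: refl_mx_sqr.
have m1 : (1 < m)%N by rewrite ltn_neqAle eq_sym elt_order_neq1.
pose t : R := pi / m%:R; pose c := cos t; pose d := sin t.
have mR0 : (0 : R) < m%:R by rewrite ltr0n.
have d0 : d != 0.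
  rewrite gt_eqF // sin_gt0_pi // divr_gt0 ?pi_gt0 //=.
  by rewrite ltr_pdivrMr // ltr_pMr ?pi_gt0 // ltr1n.
have cd : c ^+ 2 + d ^+ 2 = 1 by exact: cos2Dsin2.
have gij : gram i j = - c by rewrite mxE /= -/m (negbTE (lt0n_neq0 m0)).
have gji : gram j i = - c by rewrite gram_sym.
pose a := simple_root i; pose b := simple_root j.
have xE (v : 'cV[R]_r) : val x *m v = v - (2 * cox_form b v) *: b
    - (2 * (cox_form a v + 2 * c * cox_form b v)) *: a.
  rewrite /= -mulmxA [refl_mx j *m v]refl_mxE refl_mxE -/a -/b; congr (_ - _ *: _).
  by rewrite cox_formD -scaleNr cox_formZ cox_form_rootE gij; ring.
have xa : val x *m a = (4 * c ^+ 2 - 1) *: a + (2 * c) *: b.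
  rewrite xE !cox_form_rootE gji gram_diag; apply/matrixP => k l; rewrite !mxE.
  by ring.
have xb : val x *m b = (- (2 * c)) *: a - b.
  rewrite xE !cox_form_rootE gij gram_diag; apply/matrixP => k l; rewrite !mxE.
  by ring.
have xS k (v : 'cV[R]_r) : val (x ^+ k.+1)%g *m v = val x *m (val (x ^+ k)%g *m v).
  by rewrite expgS /= mulmxA.
pose C k := cos (t *+ (2 * k)); pose D k := sin (t *+ (2 * k)).
have CS k : C k.+1 = C k * (c ^+ 2 - d ^+ 2) - D k * (2 * c * d).
  rewrite /C /D mulnS mulrnDr [t *+ 2 + _]addrC cosD mulr2n cosD sinD -/c -/d.
  by ring.
have DS k : D k.+1 = D k * (c ^+ 2 - d ^+ 2) + C k * (2 * c * d).
  rewrite /C /D mulnS mulrnDr [t *+ 2 + _]addrC sinD mulr2n cosD sinD -/c -/d.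
  by ring.
have xka k : val (x ^+ k)%g *m a
    = (C k + D k * c / d) *: a + (D k / d) *: b.
  elim: k => [|k IH].
    by rewrite expg0 /= mul1mx /C /D muln0 mulr0n cos0 sin0 !mul0r addr0 scale1r
      scale0r addr0.
  rewrite xS IH mulmxDr -!scalemxAr xa xb CS DS.
  apply/matrixP => p q; rewrite !mxE.
  have dE : d ^+ 2 = 1 - c ^+ 2 by rewrite -cd; ring.
  field: dE.
  by [].
have xkb k : val (x ^+ k)%g *m b
    = (- (D k / d)) *: a + (C k - D k * c / d) *: b.
  elim: k => [|k IH].
    by rewrite expg0 /= mul1mx /C /D muln0 mulr0n cos0 sin0 !mul0r oppr0 addr0
      scale1r scale0r add0r.
  rewrite xS IH mulmxDr -!scalemxAr xa xb CS DS.
  apply/matrixP => p q; rewrite !mxE.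
  have dE : d ^+ 2 = 1 - c ^+ 2 by rewrite -cd; ring.
  field: dE.
  by [].
have tm : t *+ (2 * m) = pi *+ 2.
  by rewrite mulnC mulrnA -[t *+ m]mulr_natr divfK // gt_eqF.
have Cm : C m = 1 by rewrite /C tm cos2pi.
have Dm : D m = 0 by rewrite /D tm sin2pi.
have xma : val (x ^+ m)%g *m a = a.
  by rewrite xka Dm Cm !mul0r scale0r !addr0 scale1r.
have xmb : val (x ^+ m)%g *m b = b.
  by rewrite xkb Dm Cm !mul0r oppr0 scale0r add0r addr0 scale1r.
have fix0 k v : cox_form a v = 0 -> cox_form b v = 0 ->
    val (x ^+ k)%g *m v = v.
  move=> av bv; elim: k => [|k IH]; first by rewrite expg0 /= mul1mx.
  by rewrite xS IH xE av bv !mulr0 addr0 mulr0 !scale0r !subr0.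
apply: val_inj => /=.
suff H (v : 'cV[R]_r) : val (x ^+ m)%g *m v = v.
  apply/matrixP => k l; have := congr1 (fun v : 'cV_r => v k 0) (H (delta_mx l 0)).
  by rewrite /= -colE !mxE eqxx andbT.
pose p := cox_form a v; pose q := cox_form b v.
pose y := (p + c * q) / d ^+ 2; pose z := (q + c * p) / d ^+ 2.
pose v0 := v - y *: a - z *: b.
have dE : d ^+ 2 = 1 - c ^+ 2 by rewrite -cd; ring.
have aa : cox_form a a = 1 by rewrite cox_form_rootE gram_diag.
have bb : cox_form b b = 1 by rewrite cox_form_rootE gram_diag.
have ab : cox_form a b = - c by rewrite cox_form_rootE.
have ba : cox_form b a = - c by rewrite cox_form_rootE.
have v0a : cox_form a v0 = 0.
  rewrite /v0 -(scaleNr y) -(scaleNr z) !cox_formD !cox_formZ aa ab -/p /y /z.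
  by field: dE.
have v0b : cox_form b v0 = 0.
  rewrite /v0 -(scaleNr y) -(scaleNr z) !cox_formD !cox_formZ bb ba -/q /y /z.
  by field: dE.
have -> : v = v0 + z *: b + y *: a by rewrite /v0 !subrK.
by clearbody v0; rewrite !mulmxDr -!scalemxAr xma xmb fix0.
Qed.

Lemma geom_rep_exists : exists rho : W -> 'M[R]_r,
  [/\ forall i, rho (s i) = refl_mx i, rho 1%g = 1%:M
    & forall u v, rho (u * v)%g = rho u *m rho v].
Proof.
have [phi phiE] := cox_univ cox refl_gl_rel.
have phiM u v : phi (u * v)%g = (phi u * phi v)%g by rewrite gmulfM.
exists (fun w => val (phi w)); split=> [i||u v].
- by rewrite phiE.
- suff -> : phi 1%g = 1%g by [].
  by apply: (mulgI (phi 1%g)); rewrite -phiM !mulg1.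
- by rewrite phiM.
Qed.

(* w |-> (v |-> w v); characterized by the three properties above, as W is
   generated by S *)
Definition geom_rep : W -> 'M[R]_r := projT1 (cid geom_rep_exists).

Lemma geom_repE i (v : 'cV[R]_r) : geom_rep (s i) *m v =
  v - (2 * cox_form (simple_root i) v) *: simple_root i.
Proof.
by rewrite -refl_mxE /geom_rep; case: cid => rho [/= -> _ _].
Qed.

Lemma geom_rep1 : geom_rep 1%g = 1%:M.
Proof. by rewrite /geom_rep; case: cid => rho []. Qed.

Lemma geom_repM u v : geom_rep (u * v)%g = geom_rep u *m geom_rep v.
Proof. by rewrite /geom_rep; case: cid => rho []. Qed.

Definition actV (w : W) (v : 'cV[R]_r) : 'cV[R]_r := geom_rep w *m v.

Definition pairing (f : 'rV[R]_r) (v : 'cV[R]_r) : R := (f *m v) 0 0.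

Definition actVdual (w : W) (f : 'rV[R]_r) : 'rV[R]_r := f *m geom_rep w^-1%g.

Lemma pairing_act w f v : pairing (actVdual w f) (actV w v) = pairing f v.
Proof.
rewrite /pairing /actVdual /actV mulmxA -(mulmxA f) -geom_repM mulVg geom_rep1.
by rewrite mulmx1.
Qed.

Local Open Scope classical_set_scope.

Definition roots : set 'cV[R]_r :=
  [set v | exists w i, v = actV w (simple_root i)].

Definition pos_roots : set 'cV[R]_r :=
  [set v | roots v /\ exists2 c : 'I_r -> R, forall i, 0 <= c i &
    v = \sum_i c i *: simple_root i].

Definition hyperplane (v : 'cV[R]_r) : set 'rV[R]_r := [set f | pairing f v = 0].

Definition hyperplanes : set (set 'rV[R]_r) := hyperplane @` pos_roots.

Definition chamber : set 'rV[R]_r :=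
  [set f | forall i, 0 < pairing f (simple_root i)].

Definition tits_cone : set 'rV[R]_r :=
  \bigcup_w (actVdual w @` closure chamber).

Definition intersecting (Q : set (set 'rV[R]_r)) : Prop :=
  Q `<=` hyperplanes /\
  forall H1 H2, Q H1 -> Q H2 -> H1 `&` H2 `&` interior tits_cone !=set0.

End Geometric.

(* Main.v *)
(** For w in W let N(w) be the set of positive roots sent to negative roots by w.
    By induction on the length of y, the set Q is found among the hyperplanes of
    N(x) /\ N(y^-1). Write y = s y' with s simple of root a.  If the letter s is
    kept, a set for (x s, y') is carried by s to a set for (x, y).  If it is
    omitted, then a lies in N(x) /\ N(y^-1), and a set for (x, y') yields one for
    (x, y) with one more element: a itself, together with b or s b for every b of
    the old set, the choice between b and s b being made so that no two of the
    resulting hyperplanes are nested.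

    Two roots b, c with |(b, c)| < 1 are positive or negative in all four
    combinations on suitable chambers, so that H_b, H_c meet in the interior of
    the convex cone U.  Moreover (b, c) <= -1 never happens inside one N(w), and
    (b, c) >= 1 exactly when one of the half-spaces of b, c contains the other.
    The sign of a root is that of the sum of its coefficients. *)

Require Import Defs.
From mathcomp Require Import all_boot all_order all_algebra.
From mathcomp Require Import all_classical all_reals all_analysis.
From mathcomp Require Import ring lra zify.

Set Implicit Arguments.
Unset Strict Implicit.
Unset Printing Implicit Defensive.

Import Order.TTheory GRing.Theory Num.Theory.
Import numFieldNormedType.Exports.

Local Open Scope group_scope.

(** * Word length *)

Section Length.
Variables (W : groupType) (r : nat) (s : 'I_r -> W).
Hypothesis cox : coxeter_system s.

Local Notation len := (cox_length s).

Lemma cox_length_word (l : seq 'I_r) : (len (\prod_(i <- l) s i) <= size l)%N.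
Proof.
pose P := [pred k | [exists u : k.-tuple 'I_r,
  \prod_(i <- l) s i == \prod_(i <- u) s i]].
have Pl : P (size l) by apply/existsP; exists (in_tuple l).
by case: (@leastP P (ex_intro (fun n => P n) _ Pl)) => _; apply.
Qed.

Lemma cox_length_reduced w :
  exists2 l : seq 'I_r, size l = len w & w = \prod_(i <- l) s i.
Proof.
have [l wE] := cox_gen cox w.
pose P := [pred k | [exists u : k.-tuple 'I_r, w == \prod_(i <- u) s i]].
have Pl : P (size l) by apply/existsP; exists (in_tuple l); apply/eqP.
case: (@leastP P (ex_intro (fun n => P n) _ Pl)) => /existsP[u /eqP uE] _.
by exists u => //; rewrite size_tuple.
Qed.

Lemma cox_length1 : len 1 = 0%N.
Proof. by have := cox_length_word [::]; rewrite big_nil leqn0 => /eqP. Qed.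

Lemma cox_length_eq0 w : len w = 0%N -> w = 1.
Proof.
by have [[|a l] <- ->] := cox_length_reduced w; rewrite ?big_nil.
Qed.

Lemma cox_lengthM v w : (len (v * w) <= len v + len w)%N.
Proof.
have [l <- {1}->] := cox_length_reduced v; have [m <- {1}->] := cox_length_reduced w.
by rewrite -big_cat -size_cat cox_length_word.
Qed.

Lemma cox_length_gen i : (len (s i) <= 1)%N.
Proof. by have := cox_length_word [:: i]; rewrite big_seq1. Qed.

Lemma cox_lengthMl i w : (len (s i * w) <= (len w).+1)%N.
Proof. by have := cox_lengthM (s i) w; have := cox_length_gen i; lia. Qed.

Lemma cox_lengthMr i w : (len (w * s i) <= (len w).+1)%N.
Proof. by have := cox_lengthM w (s i); have := cox_length_gen i; lia. Qed.

Lemma cox_sqrK w i : w * s i * s i = w.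
Proof. by rewrite -mulgA (cox_sqr cox) mulg1. Qed.

Lemma cox_length_last w : (0 < len w)%N ->
  exists i, (len (w * s i) < len w)%N.
Proof.
have [l] := cox_length_reduced w; case/lastP: l => [<- //|l i].
rewrite size_rcons => lE wE _; exists i; rewrite -lE ltnS.
by rewrite wE -cats1 big_cat /= big_seq1 cox_sqrK cox_length_word.
Qed.

Lemma cox_lengthV w : len w^-1 = len w.
Proof.
suff H v : (len v^-1 <= len v)%N.
  by apply/eqP; rewrite eqn_leq H -{1}[w]invgK H.
have [l <- ->] := cox_length_reduced v; elim: l => [|a l IH].
  by rewrite big_nil invg1 cox_length1.
rewrite big_cons invgM (cox_inv cox) /=.
by apply: leq_trans (cox_lengthMr _ _) _; rewrite ltnS.
Qed.

(** The link from the Bruhat hypotheses to the length drops on which the construction runs. *)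
Lemma bruhat_lt_length v w : bruhat_lt s v w -> (len v < len w)%N.
Proof. by elim=> [a b [t _ []] //|a b c _ /ltn_trans + _]; apply. Qed.

End Length.

(** * Alternating words in two simple reflections *)

Section Alternating.
Variables (W : groupType) (r : nat) (s : 'I_r -> W).
Hypothesis cox : coxeter_system s.
Local Notation len := (cox_length s).

Definition alt_letter (i j : 'I_r) k := if odd k then j else i.

(* [alt_word i j k] is the alternating product of k letters that ends in s j. *)
Fixpoint alt_word i j k : W :=
  if k is k'.+1 then s (alt_letter i j k) * alt_word i j k' else 1.

Lemma alt_letterSS i j k : alt_letter i j k.+2 = alt_letter i j k.
Proof. by rewrite /alt_letter /= negbK. Qed.

Lemma alt_letter_swap i j k : alt_letter j i k = alt_letter i j k.+1.
Proof. by rewrite /alt_letter /=; case: odd. Qed.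

Lemma alt_wordS i j k :
  alt_word i j k.+1 = s (alt_letter i j k.+1) * alt_word i j k.
Proof. by []. Qed.

Lemma alt_wordSr i j k : alt_word i j k.+1 = alt_word j i k * s j.
Proof.
elim: k i j => [|k IH] i j; first by rewrite /= mul1g mulg1.
rewrite alt_wordS IH mulgA alt_letterSS alt_wordS; congr (_ * _ * _).
by rewrite alt_letter_swap.
Qed.

Lemma conj_expg (G : groupType) (a b : G) k : a * (b * a) ^+ k * b = (a * b) ^+ k.+1.
Proof.
elim: k => [|k IH]; first by rewrite expg0 mulg1 expg1.
by rewrite expgS [RHS]expgS -IH !mulgA.
Qed.

(** Turns the relation [(st)^m = 1] into the braid relation. *)
Lemma alt_word_ratio i j k : alt_word i j k * (alt_word j i k)^-1 =
  (s (alt_letter i j k) * s (alt_letter i j k.+1)) ^+ k.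
Proof.
elim: k => [|k IH]; first by rewrite /= invg1 mulg1 expg0.
rewrite !alt_wordS (alt_letter_swap i j) !alt_letterSS.
by rewrite invgM (cox_inv cox) !mulgA -(mulgA (s _)) IH conj_expg.
Qed.

Lemma alt_word_sym i j : alt_word i j (elt_order (s i * s j)) =
  alt_word j i (elt_order (s i * s j)).
Proof.
set m := elt_order _.
(* An infinite order is encoded as 0, and both words are then empty. *)
have [m0|m0] := posnP m; first by rewrite m0.
apply: (mulIg (alt_word j i m)^-1); rewrite mulgV alt_word_ratio.
rewrite /alt_letter /=; case: odd => /=; last exact: elt_order_gt0.
by rewrite /m (elt_order_sym cox) elt_order_gt0 // -(elt_order_sym cox).
Qed.

Lemma alt_word_length i j k : (len (alt_word i j k) <= k)%N.
Proof.
elim: k => [|k IH] /=; first by rewrite cox_length1.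
by apply: leq_trans (cox_lengthMl cox _ _) _.
Qed.

(** At [k] equal to the order, the braid relation makes the word end in [s i], which cancels; every
    further letter adds at most one to the length. *)
Lemma alt_word_mul_length i j k : (0 < elt_order (s i * s j) <= k)%N ->
  (len (alt_word i j k * s i)%g < k)%N.
Proof.
case/andP=> m0; elim: k => [|k IH]; first by rewrite leqNgt m0.
rewrite leq_eqVlt => /orP[/eqP mE|/IH {}IH].
  rewrite -mE alt_word_sym mE alt_wordSr (cox_sqrK cox) ltnS.
  exact: alt_word_length.
by rewrite alt_wordS -mulgA; apply: leq_ltn_trans (cox_lengthMl cox _ _) _.
Qed.

(* Take the decomposition w = v * alt_word i j k with k maximal. *)
Lemma alt_word_split i j w : (0 < len w)%N -> (len (w * s j) < len w)%N ->
  exists (v : W) k, [/\ w = v * alt_word i j k, (len w = len v + k)%N, (0 < k)%N,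
    (len v <= len (v * s i))%N & (len v <= len (v * s j))%N].
Proof.
move=> w0 wj.
pose P k := `[< exists2 v, w = v * alt_word i j k & (len w = len v + k)%N >].
have P1 : P 1%N.
  apply/asboolP; exists (w * s j); first by rewrite /= mulg1 (cox_sqrK cox).
  have := cox_lengthMr cox j (w * s j); rewrite (cox_sqrK cox); lia.
have Pb k : P k -> (k <= len w)%N by move=> /asboolP[v _ ->]; rewrite leq_addl.
case: (ex_maxnP (ex_intro (fun n => P n) _ P1) Pb) => k /asboolP[v wE lE] maxk.
have k0 : (0 < k)%N by exact: maxk.
(* If the next alternating letter shortened [v], it could be moved into the alternating factor,
   against the maximality of [k]. *)
have next : (len v <= len (v * s (alt_letter i j k.+1)))%N.
  rewrite leqNgt; apply/negP => lt; suff /maxk : P k.+1 by rewrite ltnn.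
  apply/asboolP; exists (v * s (alt_letter i j k.+1)).
    by rewrite alt_wordS mulgA (cox_sqrK cox).
  have := cox_lengthMr cox (alt_letter i j k.+1) (v * s (alt_letter i j k.+1)).
  by rewrite (cox_sqrK cox); lia.
(* If the first letter of the alternating factor shortened [v], then [w] would be shorter than
   [len v + k]. *)
have prev : (len v <= len (v * s (alt_letter i j k)))%N.
  case: k k0 wE lE {maxk next} => // k _ wE lE.
  have := cox_lengthM cox (v * s (alt_letter i j k.+1)) (alt_word i j k).
  rewrite -mulgA -alt_wordS -wE; have := alt_word_length i j k; lia.
exists v, k; split=> //; move: prev next.
all: by rewrite /alt_letter /=; case: odd.
Qed.
End Alternating.

Local Open Scope ring_scope.

(** * The geometric representation and the positivity of roots *)

Section Action.
Variables (R : realType) (W : groupType) (r : nat) (s : 'I_r -> W).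
Hypothesis cox : coxeter_system s.

Local Notation len := (cox_length s).
Local Notation "''a_' i" := (simple_root R i)
  (at level 8, i at level 2, format "''a_' i").
Local Notation B := (cox_form s).
Local Notation act := (actV cox).
Implicit Types (u v : 'cV[R]_r) (w : W) (i j : 'I_r).

Lemma act1 v : act 1%g v = v.
Proof. by rewrite /actV geom_rep1 mul1mx. Qed.

Lemma actM w1 w2 v : act (w1 * w2)%g v = act w1 (act w2 v).
Proof. by rewrite /actV geom_repM mulmxA. Qed.

Lemma actD w u v : act w (u + v) = act w u + act w v.
Proof. exact: mulmxDr. Qed.

Lemma actZ w c v : act w (c *: v) = c *: act w v.
Proof. by rewrite /actV scalemxAr. Qed.

Lemma actN w v : act w (- v) = - act w v.
Proof. exact: mulmxN. Qed.

Lemma actB w u v : act w (u - v) = act w u - act w v.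
Proof. exact: mulmxBr. Qed.

Lemma actK w v : act w^-1%g (act w v) = v.
Proof. by rewrite -actM mulVg act1. Qed.

Lemma actKV w v : act w (act w^-1%g v) = v.
Proof. by rewrite -actM mulgV act1. Qed.

Lemma act_gen i v : act (s i) v = v - (2 * B 'a_i v) *: 'a_i.
Proof. exact: geom_repE. Qed.

Lemma act_genK i v : act (s i) (act (s i) v) = v.
Proof. by rewrite -actM (cox_sqr cox) act1. Qed.

Lemma cox_formC u v : B u v = B v u.
Proof.
rewrite /cox_form -[LHS]/((u^T *m gram R s *m v) 0 0).
have -> : u^T *m gram R s *m v = (v^T *m gram R s *m u)^T.
  rewrite !trmx_mul trmxK mulmxA; congr (_ *m _ *m _).
  by apply/matrixP => i j; rewrite [RHS]mxE (gram_sym R cox).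
by rewrite mxE.
Qed.

Lemma cox_formN u v : B u (- v) = - B u v.
Proof. by rewrite -scaleN1r cox_formZ mulN1r. Qed.

Lemma cox_formB u v1 v2 : B u (v1 - v2) = B u v1 - B u v2.
Proof. by rewrite cox_formD cox_formN. Qed.

Lemma cox_formNl u v : B (- u) v = - B u v.
Proof. by rewrite cox_formC cox_formN cox_formC. Qed.

Lemma cox_formBl u1 u2 v : B (u1 - u2) v = B u1 v - B u2 v.
Proof. by rewrite cox_formC cox_formB !(cox_formC v). Qed.

Lemma cox_formZl c u v : B (c *: u) v = c * B u v.
Proof. by rewrite cox_formC cox_formZ cox_formC. Qed.

Lemma cox_form_simple i : B 'a_i 'a_i = 1.
Proof. by rewrite cox_form_rootE (gram_diag R cox). Qed.

Lemma cox_form_act w u v : B (act w u) (act w v) = B u v.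
Proof.
have [l ->] := cox_gen cox w; elim: l u v => [|i l IH] u v.
  by rewrite big_nil !act1.
rewrite big_cons !actM !act_gen !(cox_formB, cox_formBl) !(cox_formZ, cox_formZl).
rewrite cox_form_simple IH (cox_formC _ 'a_i); ring.
Qed.

Lemma act_gen_simple i : act (s i) 'a_i = - 'a_i.
Proof.
by rewrite act_gen cox_form_simple mulr1 scaler_nat mulr2n opprD addNKr.
Qed.

Lemma simple_rootE i j : 'a_i j 0 = (j == i)%:R.
Proof. by rewrite mxE andbT. Qed.

(* The coefficients [sin (k * t) / sin t] with [t = pi / m], or [k] when [m] is
   infinite, of the roots in the dihedral subgroup generated by two simple
   reflections. *)
Lemma alt_word_act i j : i != j ->
  exists2 q : nat -> R,
    forall k, (elt_order (s i * s j) == 0)%N || (k <= elt_order (s i * s j))%N ->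
      0 <= q k
  & forall k, act (alt_word s i j k) 'a_i =
      q k.+1 *: 'a_(alt_letter i j k) + q k *: 'a_(alt_letter i j k.+1).
Proof.
move=> ij; pose m := elt_order (s i * s j).
suff [q [q0 q1 qge qrec]] : exists q : nat -> R, [/\ q 0%N = 0, q 1%N = 1,
    forall k, (m == 0)%N || (k <= m)%N -> 0 <= q k
  & forall k, q k.+2 = - (2 * gram R s i j) * q k.+1 - q k].
  exists q => // k; elim: k => [|k IH].
    by rewrite /= act1 q0 q1 scale0r addr0 scale1r.
  rewrite alt_wordS actM IH actD !actZ alt_letterSS act_gen_simple.
  rewrite act_gen cox_form_rootE.
  have -> : gram R s (alt_letter i j k.+1) (alt_letter i j k) = gram R s i j.
    by rewrite /alt_letter /=; case: odd; rewrite //= (gram_sym R cox).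
  by rewrite qrec; apply/matrixP => x y; rewrite !mxE; ring.
have gE : gram R s i j = if m == 0%N then -1 else - cos (pi / m%:R).
  by rewrite mxE.
rewrite gE; have [m0|m0] := eqVneq m 0%N.
  exists (fun k => k%:R); split=> // k.
  by rewrite -!natr1; ring.
have m1 : (1 < m)%N by have := elt_order_neq1 cox ij; rewrite -/m; lia.
pose t : R := pi / m%:R.
have mR0 : (0 : R) < m%:R by rewrite ltr0n; lia.
have t0 : 0 < t by rewrite divr_gt0 ?pi_gt0.
have st : 0 < sin t.
  by rewrite sin_gt0_pi // t0 /= ltr_pdivrMr // ltr_pMr ?pi_gt0 // ltr1n.
exists (fun k => sin (t *+ k) / sin t); split=> [||k|k].
- by rewrite mulr0n sin0 mul0r.
- by rewrite mulr1n divff // gt_eqF.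
- rewrite /= => km; rewrite divr_ge0 ?(ltW st) // sin_ge0_pi //.
  rewrite mulrn_wge0 ?(ltW t0) //=.
  have -> : t *+ k = pi * k%:R / m%:R by rewrite -[LHS]mulr_natr mulrAC.
  by rewrite ler_pdivrMr // ler_wpM2l ?pi_ge0 // ler_nat.
(* The recurrence is sin(z + t) + sin(z - t) = 2 sin z cos t. *)
have -> : t *+ k.+2 = t *+ k.+1 + t by rewrite mulrSr.
have -> : t *+ k = t *+ k.+1 - t by rewrite mulrSr addrK.
rewrite sinD sinB -/t; field; exact: lt0r_neq0.
Qed.

(* Humphreys, Reflection Groups and Coxeter Groups, Theorem 5.4. *)
Lemma act_simple_ge0 w i : (len w <= len (w * s i)%g)%N ->
  forall x, 0 <= act w 'a_i x 0.
Proof.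
have [n] := ubnP (len w); elim: n w i => // n IH w i; rewrite ltnS => wn wi.
have [/(cox_length_eq0 cox) ->|w0] := posnP (len w).
  by move=> x; rewrite act1 simple_rootE ler0n.
have [j wj] := cox_length_last cox w0.
have ij : i != j by apply/eqP => ij; move: wi; rewrite ij leqNgt wj.
(* The dihedral factor sends ['a_i] to a nonnegative combination of two simple roots, which the
   shorter [v] keeps nonnegative by induction. *)
have [v [k [wE lE k0 vi vj]]] := alt_word_split cox i w0 wj.
have [q q_ge0 qE] := alt_word_act ij => x.
(* Otherwise [w * s i] would be shorter than [w]. Strictness matters, as [q k.+1] occurs too. *)
have km : (elt_order (s i * s j) == 0)%N || (k < elt_order (s i * s j))%N.
  have [->//|m0] := posnP (elt_order (s i * s j)).
  apply/orP; right; rewrite ltnNge; apply/negP => mk.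
  have := @alt_word_mul_length _ _ _ cox i j k; rewrite m0 mk => /(_ isT).
  have := cox_lengthM cox v (alt_word s i j k * s i)%g.
  rewrite mulgA -wE => h1 h2; have := leq_trans wi h1.
  by rewrite lE leq_add2l leqNgt h2.
have pos z : (z == i) || (z == j) -> 0 <= act v 'a_z x 0.
  by case/orP => /eqP ->; apply: IH => //; lia.
have al z : (alt_letter i j z == i) || (alt_letter i j z == j).
  by rewrite /alt_letter; case: odd; rewrite eqxx ?orbT.
have coef z c : 0 <= c -> 0 <= (c *: act v 'a_(alt_letter i j z)) x 0.
  by move=> c0; rewrite mxE mulr_ge0 ?pos ?al.
rewrite wE actM qE actD !actZ mxE addr_ge0 // coef // q_ge0 //.
by case/orP: km => [->//|km]; rewrite ltnW ?orbT.
Qed.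

End Action.

(** * Heights and a recurrence without positive solutions *)

Section Height.
Variables (R : realType) (r : nat).
Implicit Types (u v : 'cV[R]_r).

Definition height v := \sum_i v i 0.

Lemma heightD u v : height (u + v) = height u + height v.
Proof. by rewrite -big_split; apply: eq_bigr => i _; rewrite mxE. Qed.

Lemma heightZ c v : height (c *: v) = c * height v.
Proof. by rewrite /height mulr_sumr; apply: eq_bigr => i _; rewrite mxE. Qed.

Lemma heightN v : height (- v) = - height v.
Proof. by rewrite -scaleN1r heightZ mulN1r. Qed.

Lemma heightB u v : height (u - v) = height u - height v.
Proof. by rewrite heightD heightN. Qed.

Lemma height_gt0 v : v != 0 -> (forall i, 0 <= v i 0) -> 0 < height v.
Proof.
move=> v0 vge; rewrite lt_def sumr_ge0 ?andbT // psumr_eq0 //.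
apply: contraNN v0 => /allP v0; apply/eqP/matrixP => i j; rewrite ord1 mxE.
by apply/eqP/(implyP (v0 i (mem_index_enum i))).
Qed.

End Height.

(* The sequence is concave, hence nondecreasing, hence its differences decrease
   by at least [2 * (1 - c) * m 0] at every step. *)
Lemma no_positive_recurrence (R : realType) (m : nat -> R) (c : R) : c < 1 ->
  (forall k, 0 < m k) -> (forall k, m k.+2 = 2 * c * m k.+1 - m k) -> False.
Proof.
move=> c1 m0 mrec.
pose d k := m k.+1 - m k.
have dS k : d k.+1 = d k - 2 * (1 - c) * m k.+1 by rewrite /d mrec; ring.
have dle k n : d (k + n)%N <= d k.
  elim: n => [|n IH]; rewrite ?addn0 // addnS dS.
  by apply: le_trans IH; rewrite gerBl mulr_ge0 ?ltW // mulr_gt0 // subr_gt0.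
have d0 k : 0 <= d k.
  rewrite leNgt; apply/negP => dk.
  have mle n : m (k + n)%N <= m k + n%:R * d k.
    elim: n => [|n IH]; first by rewrite addn0 mul0r addr0.
    rewrite addnS -[m (k + n).+1](subrK (m (k + n)%N)) -/(d _) -natr1.
    by have := dle k n; lra.
  have := Num.Theory.archi_boundP (ltW (divr_gt0 (m0 k) (eqbRL (oppr_gt0 _) dk))).
  set n := Num.bound _; rewrite ltr_pdivrMr ?oppr_gt0 // => lt.
  by have := mle n; have := m0 (k + n)%N; lra.
have mge k : m 0%N <= m k.
  elim: k => // k /le_trans; apply; by rewrite -subr_ge0 d0.
pose e := 2 * (1 - c) * m 0%N.
have e0 : 0 < e by rewrite mulr_gt0 // mulr_gt0 // subr_gt0.
have dle' n : d n <= d 0%N - n%:R * e.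
  elim: n => [|n IH]; first by rewrite mul0r subr0.
  rewrite dS -natr1; have : e <= 2 * (1 - c) * m n.+1; last by lra.
  by rewrite ler_wpM2l // mulr_ge0 // subr_ge0 ltW.
have := Num.Theory.archi_boundP (divr_ge0 (d0 0%N) (ltW e0)).
set n := Num.bound _; rewrite ltr_pdivrMr // => lt.
by have := dle' n; have := d0 n; lra.
Qed.

(** * Signs of roots, inversions and nested half-spaces *)

Section Roots.
Variables (R : realType) (W : groupType) (r : nat) (s : 'I_r -> W).
Hypothesis cox : coxeter_system s.

Local Notation len := (cox_length s).
Local Notation "''a_' i" := (simple_root R i)
  (at level 8, i at level 2, format "''a_' i").
Local Notation B := (cox_form s).
Local Notation act := (actV cox).
Local Notation ht := (@height R r).
Local Notation root := (@Defs.roots R W r s cox).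
Implicit Types (b c : 'cV[R]_r) (w : W) (i j : 'I_r).

Lemma root_simple i : root 'a_i.
Proof. by exists 1%g, i; rewrite act1. Qed.

Lemma root_act w b : root b -> root (act w b).
Proof. by move=> [v [i ->]]; exists (w * v)%g, i; rewrite actM. Qed.

Lemma root_opp b : root b -> root (- b).
Proof.
move=> [w [i ->]]; exists (w * s i)%g, i.
by rewrite actM act_gen_simple actN.
Qed.

Lemma root_form b : root b -> B b b = 1.
Proof. by move=> [w [i ->]]; rewrite cox_form_act cox_form_simple. Qed.

Lemma root_neq0 b : root b -> b != 0.
Proof.
move=> /root_form; apply: contra_eq_neq => ->.
by rewrite -(scale0r 0) cox_formZ mul0r eq_sym oner_eq0.
Qed.

Lemma root_reflection b : root b ->
  exists t, forall v, act t v = v - (2 * B b v) *: b.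
Proof.
move=> [w [i ->]]; exists (w * s i * w^-1)%g => v.
rewrite !actM act_gen actB actZ actKV -(cox_form_act cox w _ (act w^-1%g v)).
by rewrite actKV.
Qed.

(** Positivity is applied to [w] and to [w * s i], which send ['a_i] to opposite roots; this also
    rules out equal lengths. *)
Lemma act_simple_ht w i :
  (0 < ht (act w 'a_i)) = (len w < len (w * s i)%g)%N /\
  (ht (act w 'a_i) < 0) = (len (w * s i)%g < len w)%N.
Proof.
have pos v : (len v <= len (v * s i)%g)%N -> 0 < ht (act v 'a_i).
  move=> /(act_simple_ge0 R cox) ge0; apply: height_gt0 => //.
  by apply/root_neq0/root_act/root_simple.
have neg v : (len (v * s i)%g <= len v)%N -> ht (act v 'a_i) < 0.
  move=> vi; have := pos (v * s i)%g; rewrite (cox_sqrK cox) => /(_ vi).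
  by rewrite actM act_gen_simple actN heightN oppr_gt0.
have [lt|lt|eq] := ltngtP (len w) (len (w * s i)%g).
- by have h := pos w (ltnW lt); rewrite h lt_gtF.
- by have h := neg w (ltnW lt); rewrite h lt_gtF.
- have := pos w; have := neg w; rewrite eq leqnn => /(_ isT) + /(_ isT); lra.
Qed.

Lemma root_sign b : root b ->
  (0 < ht b /\ forall x, 0 <= b x 0) \/ (ht b < 0 /\ forall x, b x 0 <= 0).
Proof.
move=> rb; case: (rb) => w [i bE].
have [wi|/ltnW wi] := leqP (len w) (len (w * s i)%g).
  have ge0 := act_simple_ge0 R cox wi; left; rewrite bE; split=> //.
  by apply: height_gt0 => //; rewrite -bE root_neq0.
right; have := @act_simple_ge0 R _ _ _ cox (w * s i)%g i.
rewrite (cox_sqrK cox) => /(_ wi).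
rewrite actM act_gen_simple actN -bE => ge0; split=> [|x].
  rewrite -oppr_gt0 -heightN height_gt0 // oppr_eq0 root_neq0 //.
by have := ge0 x; rewrite mxE oppr_ge0.
Qed.

Lemma root_ht_lt0 b : root b -> (ht b < 0) = ~~ (0 < ht b).
Proof. by case/root_sign => -[h _]; rewrite (lt_gtF h) h. Qed.

Lemma simple_ht i : ht 'a_i = 1.
Proof.
rewrite /height (bigD1 i) //= big1 ?addr0 ?simple_rootE ?eqxx // => j ji.
by rewrite simple_rootE (negbTE ji).
Qed.

(** As [s i] changes only the coordinate at [i], all others are both nonnegative and nonpositive;
    the norm 1 fixes the remaining one. *)
Lemma act_gen_ht_lt0 i b :
  root b -> 0 < ht b -> ht (act (s i) b) < 0 -> b = 'a_i.
Proof.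
move=> rb hb hsb.
have [[_ b_ge0]|[h _]] := root_sign rb; last by rewrite lt_gtF in h.
have [[h _]|[_ sb_le0]] := root_sign (root_act (s i) rb).
  by rewrite lt_gtF in h.
have bE : b = b i 0 *: 'a_i.
  apply/matrixP => x y; rewrite ord1 [RHS]mxE simple_rootE.
  have [->|xi] := eqVneq x i; first by rewrite mulr1.
  rewrite mulr0; apply/eqP; rewrite eq_le b_ge0 andbT.
  have := sb_le0 x; rewrite act_gen mxE [X in _ + X]mxE [X in _ - X]mxE simple_rootE.
  by rewrite (negbTE xi) mulr0 subr0.
have := root_form rb.
rewrite bE cox_formZ (cox_formZl cox) (cox_form_simple R cox) mulr1.
rewrite -expr2 => /eqP; rewrite sqrf_eq1 => /orP[/eqP->|/eqP b1].
  by rewrite scale1r.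
by have := b_ge0 i; rewrite b1 lerNr oppr0 ler10.
Qed.

(** Induction on the length of [w]: a last letter [s i] is moved from [w] to both roots, which
    preserves the form. *)
Lemma inversions_form_gt w b c : root b -> root c -> 0 < ht b -> 0 < ht c ->
  ht (act w b) < 0 -> ht (act w c) < 0 -> -1 < B b c.
Proof.
move=> rb rc hb hc wb wc; rewrite ltNge; apply/negP.
have [n] := ubnP (len w).
elim: n w b c rb rc hb hc wb wc => // n IH w b c rb rc hb hc wb wc.
rewrite ltnS => wn bc.
have [/(cox_length_eq0 cox) w1|w0] := posnP (len w).
  by move: wb; rewrite w1 act1; lra.
have [i wi] := cox_length_last cox w0.
have n1 : (len (w * s i)%g < n)%N by lia.
(* The case where s i makes one of the two roots, say b, negative: then b is
   simple and (c, s i c) is another pair of inversions. *)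
have simple b' c' : root b' -> root c' -> 0 < ht b' -> 0 < ht c' ->
    ht (act w b') < 0 -> ht (act w c') < 0 -> B b' c' <= -1 ->
    ht (act (s i) b') < 0 -> False.
  move=> rb' rc' hb' hc' wb' wc' bc' sb'.
  have bE := act_gen_ht_lt0 rb' hb' sb'; rewrite bE in rb' hb' wb' bc' sb' *.
  have scE : act (s i) c' = c' - (2 * B 'a_i c') *: 'a_i by rewrite act_gen.
  (* The new pair has form 1 - 2 (a, c')^2, again at most -1. *)
  apply: (IH (w * s i)%g c' (act (s i) c')) => //.
  - exact: root_act.
  - by rewrite scE heightB heightZ simple_ht; lra.
  - by rewrite actM scE actB actZ heightB heightZ; nra.
  - by rewrite actM act_genK.
  - by rewrite scE cox_formB cox_formZ root_form // (cox_formC cox c'); nra.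
have [sb|sb] := ltP (ht (act (s i) b)) 0; first exact: (simple b c).
have [sc|sc] := ltP (ht (act (s i) c)) 0.
  by apply: (simple c b) => //; rewrite (cox_formC cox).
have gt0 v : root v -> 0 <= ht v -> 0 < ht v.
  by case/root_sign => -[h _] //; rewrite leNgt h.
apply: (IH (w * s i)%g (act (s i) b) (act (s i) c)); rewrite ?cox_form_act //.
- exact: root_act.
- exact: root_act.
- exact/gt0/sb/root_act.
- exact/gt0/sc/root_act.
- by rewrite actM act_genK.
- by rewrite actM act_genK.
Qed.

(* If there were none, applying the reflections in b and c alternately would
   produce only positive roots, whose heights satisfy
   m (k+2) = - 2 (b, c) m (k+1) - m k. *)
Lemma negative_quadrant b c : root b -> root c -> -1 < B b c ->
  (exists w, 0 < ht (act w b) /\ 0 < ht (act w c)) ->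
  exists w, ht (act w b) < 0 /\ ht (act w c) < 0.
Proof.
move=> rb rc bc [w [wb wc]]; apply: contrapT => none.
have pos v : ht (act v b) < 0 -> 0 < ht (act v c).
  move=> vb; rewrite -[_ < _]negbK -root_ht_lt0; last exact: root_act.
  by apply/negP => vc; apply: none; exists v.
have pos' v : ht (act v c) < 0 -> 0 < ht (act v b).
  move=> vc; rewrite -[_ < _]negbK -root_ht_lt0; last exact: root_act.
  by apply/negP => vb; apply: none; exists v.
have [tb tbE] := root_reflection rb; have [tc tcE] := root_reflection rc.
have fbb := root_form rb; have fcc := root_form rc.
have cb : B c b = B b c by rewrite (cox_formC cox).
pose step (p : R * R) := (p.2, - (2 * B b c) * p.2 - p.1).
pose p k := iter k step (ht (act w b), ht (act w c) - 2 * B b c * ht (act w b)).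
(* After [k.+1] reflections the root reflected last has height [- (p k).1] and the other one
   [(p k).2]; [b] and [c] swap roles at each step. *)
have key k : exists v, (ht (act v b) = - (p k).1 /\ ht (act v c) = (p k).2) \/
    (ht (act v c) = - (p k).1 /\ ht (act v b) = (p k).2).
  elim: k => [|k [v IH]].
    exists (w * tb)%g; left; rewrite !actM !tbE fbb !actB !actZ !heightB !heightZ /=.
    by split; ring.
  case: IH => -[h1 h2].
    exists (v * tc)%g; right; rewrite !actM !tcE fcc !actB !actZ !heightB !heightZ.
    by rewrite cb h1 h2 /=; split; ring.
  exists (v * tb)%g; left; rewrite !actM !tbE fbb !actB !actZ !heightB !heightZ.
  by rewrite h1 h2 /=; split; ring.
have p0 k : 0 < (p k).1.
  elim: k => // k IH; rewrite /=.
  have [v [[h1 h2]|[h1 h2]]] := key k; rewrite -h2.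
    by apply: pos; rewrite h1 oppr_lt0.
  by apply: pos'; rewrite h1 oppr_lt0.
apply: (@no_positive_recurrence R (fun k => (p k).1) (- B b c)) => [|//|k].
  by lra.
by rewrite /=; ring.
Qed.

(** The half-space of a root is taken inside [W], as the set of [w] making it negative. *)
Definition nested b c := forall w, ht (act w b) < 0 -> ht (act w c) < 0.

Lemma nested_trans b c d : nested b c -> nested c d -> nested b d.
Proof. by move=> h1 h2 w /h1/h2. Qed.

Lemma nested_act v b c : nested (act v b) (act v c) <-> nested b c.
Proof.
split=> h w; last by rewrite -!actM; exact: h.
by have := h (w * v^-1)%g; rewrite !actM !actK.
Qed.

(** Once [b] is moved to a simple root ['a_i], the image of [c] is a positive root made negative by
    [s i], hence ['a_i]. *)
Lemma nested_antisym b c : root b -> root c -> nested b c -> nested c b -> b = c.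
Proof.
move=> [w [i ->]] rc bc cb.
have rwc := root_act w^-1%g rc.
have -> : c = act w (act w^-1%g c) by rewrite actKV.
congr act; apply/esym/(act_gen_ht_lt0 rwc).
  rewrite -[_ < _]negbK -root_ht_lt0 //; apply/negP => /cb.
  by rewrite actK simple_ht; lra.
by rewrite -actM; apply: bc; rewrite actM actK act_gen_simple heightN simple_ht; lra.
Qed.

(** If neither nesting holds, some [v] and [w] witness this, and [w * v^-1] inverts both positive
    roots [act v (- b)] and [act v c]; so the form of [- b] and [c] exceeds -1. *)
Lemma form_ge1_nested b c : root b -> root c -> 1 <= B b c ->
  nested b c \/ nested c b.
Proof.
move=> rb rc bc; apply: contrapT => /not_orP[nbc ncb].
have [v [vb vc]] : exists v, ht (act v b) < 0 /\ 0 < ht (act v c).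
  apply: contrapT => none; apply: nbc => w wb.
  rewrite root_ht_lt0; last exact: root_act.
  by apply/negP => wc; apply: none; exists w.
have [w [wc wb]] : exists v, ht (act v c) < 0 /\ 0 < ht (act v b).
  apply: contrapT => none; apply: ncb => w wb.
  rewrite root_ht_lt0; last exact: root_act.
  by apply/negP => wc; apply: none; exists w.
have := @inversions_form_gt (w * v^-1)%g (act v (- b)) (act v c).
rewrite cox_form_act (cox_formNl cox) !actM !actK !actN !heightN !oppr_gt0 oppr_lt0.
by move=> /(_ (root_opp (root_act v rb)) (root_act v rc) vb vc wb wc); lra.
Qed.

(** For a form below 1, [negative_quadrant] on [b] and [- c] contradicts the nesting. If its
    starting chamber is missing, the nesting goes both ways and [b = c]. *)
Lemma nested_form_ge1 b c : root b -> root c -> nested b c -> 1 <= B b c.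
Proof.
move=> rb rc bc; rewrite leNgt; apply/negP => lt.
have [[v [vb vc]]|none] := pselect (exists v, 0 < ht (act v b) /\ ht (act v c) < 0).
  have [||w] := @negative_quadrant b (- c) rb (root_opp rc).
  - by rewrite cox_formN; lra.
  - by exists v; rewrite actN heightN oppr_gt0.
  by rewrite actN heightN oppr_lt0 => -[/bc]; lra.
have cb : nested c b.
  move=> w wc; rewrite root_ht_lt0; last exact: root_act.
  by apply/negP => wb; apply: none; exists w.
by move: lt; rewrite (nested_antisym rb rc bc cb) root_form // ltxx.
Qed.

End Roots.

(** * Common inversions, built letter by letter *)

Section Folding.
Variables (R : realType) (W : groupType) (r : nat) (s : 'I_r -> W).
Hypothesis cox : coxeter_system s.

Local Notation len := (cox_length s).
Local Notation "''a_' i" := (simple_root R i)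
  (at level 8, i at level 2, format "''a_' i").
Local Notation B := (cox_form s).
Local Notation act := (actV cox).
Local Notation ht := (@height R r).
Local Notation root := (@Defs.roots R W r s cox).
Local Notation nested := (nested cox).
Implicit Types (b c : 'cV[R]_r) (x y w : W) (i j : 'I_r) (Q : seq 'cV[R]_r).

Definition inversion w b := [/\ root b, 0 < ht b & ht (act w b) < 0].

(* By inversions_form_gt, the hyperplanes of two inversions of the same element
   can be disjoint only if the form is at least 1. *)
Definition crossing_inversions x y Q := [/\ uniq Q,
  forall b, b \in Q -> inversion x b /\ inversion y^-1%g b &
  forall b c, b \in Q -> c \in Q -> b != c -> B b c < 1].

(** Only ['a_i] could turn negative under [s i], and it is not an inversion of [w] when [s i]
    lengthens [w]. *)
Lemma inversion_gen_act i w b : (len w < len (w * s i)%g)%N ->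
  inversion w b -> inversion (w * s i)%g (act (s i) b).
Proof.
move=> wi [rb hb wb]; split; [exact: root_act| |by rewrite actM act_genK].
rewrite -[_ < _]negbK -(root_ht_lt0 (root_act _ rb)); apply/negP => sb.
have := (act_simple_ht R cox w i).1; rewrite wi -(act_gen_ht_lt0 rb hb sb).
by rewrite lt_gtF.
Qed.

Lemma cox_lengthVgen i y : (len y < len (s i * y)%g)%N ->
  (len y^-1%g < len (y^-1 * s i)%g)%N.
Proof.
by rewrite -(cox_lengthV cox y) -(cox_lengthV cox (s i * y)%g) invgM (cox_inv cox).
Qed.

Lemma crossing_cross x y i Q : (len y < len (s i * y)%g)%N ->
  crossing_inversions (x * s i)%g y Q ->
  crossing_inversions x (s i * y)%g (map (act (s i)) Q).
Proof.
move=> yi [Quniq Qinv QB]; split.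
- by rewrite map_inj_uniq // => b c /(congr1 (act (s i))); rewrite !act_genK.
- move=> _ /mapP[b /Qinv[[rb hb xb] yb] ->].
  have yb' := inversion_gen_act (cox_lengthVgen yi) yb.
  rewrite invgM (cox_inv cox); split=> //.
  by case: yb' => rb' hb' _; split=> //; rewrite -actM.
- move=> _ _ /mapP[b bQ ->] /mapP[c cQ ->] bc; rewrite cox_form_act QB //.
  by apply: contraNneq bc => ->.
Qed.

(* The new set consists of the simple root a and, for every b in Q, of b or of
   its reflection s b. A nonnegative choice of sign against a (b if (a, b) > 0,
   s b otherwise) yields common inversions of x and (s y)^-1, but a mixed pair
   (s b, c) may then be nested; in that case one of the two choices is reversed,
   namely the one for which nestedness makes the other choice an inversion too. *)
Lemma crossing_fold x y i Q : (len (x * s i)%g < len x)%N ->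
  (len y < len (s i * y)%g)%N -> crossing_inversions x y Q ->
  exists2 Q', size Q' = (size Q).+1 & crossing_inversions x (s i * y)%g Q'.
Proof.
move=> xi yi [Quniq Qinv QB]; set a := 'a_i.
have yVi := cox_lengthVgen yi.
have xa : ht (act x a) < 0 by rewrite (act_simple_ht R cox x i).2.
have ya : 0 < ht (act y^-1 a) by rewrite (act_simple_ht R cox y^-1%g i).1.
have ha : ht a = 1 by exact: simple_ht.
have ra : root a by exact: root_simple.
have yVE b : act (s i * y)^-1%g b = act y^-1%g (act (s i) b).
  by rewrite invgM (cox_inv cox) actM.
have sE b : act (s i) b = b - (2 * B a b) *: a by exact: act_gen.
have xsE b : ht (act x (act (s i) b)) = ht (act x b) - 2 * B a b * ht (act x a).
  by rewrite sE actB actZ heightB heightZ.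
have ysE b : ht (act y^-1 (act (s i) b))
    = ht (act y^-1 b) - 2 * B a b * ht (act y^-1 a).
  by rewrite sE actB actZ heightB heightZ.
have Bsl b c : B (act (s i) b) c = B b c - 2 * B a b * B a c.
  by rewrite sE (cox_formBl cox) (cox_formZl cox).
have Bas b : B a (act (s i) b) = - B a b.
  by rewrite -(cox_form_act cox (s i)) act_genK act_gen_simple (cox_formNl cox).
have inv_x b c : inversion x b -> inversion x c -> -1 < B b c.
  by move=> [rb hb xb] [rc hc xc]; exact: (inversions_form_gt rb rc hb hc xb xc).
have ax : inversion x a by split; rewrite ?ha.
have ay : inversion (s i * y)^-1%g a.
  by split; rewrite ?ha // yVE act_gen_simple actN heightN oppr_lt0.
have say b : b \in Q -> inversion (s i * y)^-1%g (act (s i) b).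
  by move=> /Qinv[_ /(inversion_gen_act yVi)]; rewrite invgM (cox_inv cox).
have sx b : b \in Q -> ht (act x (act (s i) b)) < 0 -> inversion x (act (s i) b).
  by move=> /say[rb hb _]; split.
(* The lower bound comes from the inversions [a], [b] of [x], the upper one from the inversions [a],
   [act (s i) b] of [(s i * y)^-1]. *)
have Ba b : b \in Q -> -1 < B a b < 1.
  move=> bQ; have [bx _] := Qinv b bQ; rewrite inv_x //=.
  have [rb hb yb] := say b bQ; have [_ ha' ya'] := ay.
  by have := inversions_form_gt ra rb ha' hb ya' yb; rewrite Bas; lra.
(* Reasons to reverse a choice: the nesting makes [act (s i) b] an inversion of [x], respectively
   [b] one of [(s i * y)^-1]. The trivial nesting [c = act (s i) b] is left out. *)
pose pos_flip b := `[< exists2 c, c \in Q &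
  [/\ B a c <= 0, c != act (s i) b & nested c (act (s i) b)] >].
pose neg_flip b := `[< exists2 c, c \in Q & 0 < B a c /\ nested (act (s i) c) b >].
pose keep b := if 0 < B a b then ~~ pos_flip b else neg_flip b.
pose phi b := if keep b then b else act (s i) b.
have phi_inv b : b \in Q -> inversion x (phi b) /\ inversion (s i * y)^-1%g (phi b).
  move=> bQ; have [bx by'] := Qinv b bQ; have [rb hb yb] := by'; have [_ _ xb] := bx.
  rewrite /phi /keep /pos_flip /neg_flip; case: ltP => Bab; case: asboolP => //=.
  - move=> [c cQ [Bac _ ncb]]; split; last exact: say.
    by apply: sx => //; apply: ncb; case: (Qinv c cQ) => -[].
  - by move=> _; split=> //; split=> //; rewrite yVE ysE; nra.
  - move=> [c cQ [Bac ncb]]; split=> //; split=> //; apply: ncb.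
    by rewrite yVE act_genK; case: (Qinv c cQ) => _ [].
  - by move=> _; split; [apply: sx => //; rewrite xsE; nra|exact: say].
have nestQ b c : b \in Q -> c \in Q -> nested b c -> b = c.
  move=> bQ cQ nbc; apply/eqP/negP => /negP bc.
  have [[rb _ _] _] := Qinv b bQ; have [[rc _ _] _] := Qinv c cQ.
  by have := nested_form_ge1 rb rc nbc; have := QB b c bQ cQ bc; lra.
have mixed b c : b \in Q -> c \in Q -> b != c -> ~~ keep b -> keep c ->
    B (act (s i) b) c < 1.
  move=> bQ cQ bc; have := QB b c bQ cQ bc; rewrite /keep => Bbc kb kc.
  rewrite ltNge; apply/negP => Bsbc.
  have [rb _ _] : inversion x b by case: (Qinv b bQ).
  have [rc _ _] : inversion x c by case: (Qinv c cQ).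
  have rsb := root_act (s i) rb; have rsc := root_act (s i) rc.
  have nsb b1 b2 : nested (act (s i) b1) b2 -> nested b1 (act (s i) b2).
    by move=> h; apply/(nested_act cox (s i)); rewrite act_genK.
  (* Since [B b c < 1], a form of at least 1 after reflection needs opposite signs. *)
  have Bab : B a b * B a c < 0 by move: Bsbc; rewrite Bsl; lra.
  move: kb kc; case: (ltP 0 (B a b)) => Bb; case: (ltP 0 (B a c)) => Bc.
  - by nra.
  (* Both choices were reversed. Transitivity and [nestQ] nest [act (s i) b] in [c] and then give
     [b' = c], so the two are nested both ways, against [b'sb]. *)
  - rewrite negbK => /asboolP[b' b'Q [_ b'sb nb']] /asboolP[c' c'Q [_ nc']].
    have nsbc : nested (act (s i) b) c.
      have [//|ncsb] := form_ge1_nested rsb rc Bsbc.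
      have /(nested_act cox (s i)) nc'b := nested_trans nc' ncsb.
      by rewrite -(nestQ _ _ c'Q bQ nc'b).
    have b'c := nestQ _ _ b'Q cQ (nested_trans nb' nsbc).
    rewrite b'c in b'sb nb'.
    by move: b'sb; rewrite (nested_antisym rc rsb nb' nsbc) eqxx.
  (* Neither choice was reversed, but nesting of [b] and [act (s i) c] in either direction would
     have reversed one. *)
  - move=> /asboolP nneg /asboolP npos.
    have nbsc : ~ nested (act (s i) c) b by move=> h; apply: nneg; exists c.
    have Bbsc : 1 <= B b (act (s i) c).
      by rewrite -(cox_form_act cox (s i)) act_genK.
    have [h|//] := form_ge1_nested rb rsc Bbsc.
    apply: npos; exists b => //; split=> //.
    by apply/eqP => bE; apply: nbsc; rewrite bE => w.
  - by nra.
have phiB b c : b \in Q -> c \in Q -> b != c -> B (phi b) (phi c) < 1.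
  move=> bQ cQ bc; rewrite /phi; case: ifPn => kb; case: ifPn => kc.
  - exact: QB.
  - by rewrite (cox_formC cox) mixed // eq_sym.
  - exact: mixed.
  - by rewrite cox_form_act QB.
have phi_inj : {in Q &, injective phi}.
  move=> b c bQ cQ bc; apply/eqP/negP => /negP ne; have := phiB b c bQ cQ ne.
  by rewrite bc root_form ?ltxx //; case: (phi_inv c cQ) => -[].
have Baphi b : b \in Q -> B a (phi b) < 1.
  by move=> /Ba; rewrite /phi; case: ifP => _; rewrite ?Bas; lra.
exists (a :: map phi Q); first by rewrite /= size_map.
split.
- rewrite /= map_inj_in_uniq // Quniq andbT; apply/mapP => -[b bQ aE].
  by have := Baphi b bQ; rewrite -aE root_form // ltxx.
- by move=> b; rewrite inE => /predU1P[->//|/mapP[c cQ ->]]; exact: phi_inv.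
move=> b c; rewrite !inE => /predU1P[->|/mapP[b' b'Q ->]].
  by move=> /predU1P[->|/mapP[c' c'Q -> _]]; rewrite ?eqxx // Baphi.
move=> /predU1P[-> _|/mapP[c' c'Q ->] ne]; first by rewrite (cox_formC cox) Baphi.
by rewrite phiB //; apply: contraNneq ne => ->.
Qed.

Local Notation subword u f n := (\prod_(0 <= j < n | ~~ f j) s (u j))%g.

(** [f] marks the omitted letters. The induction removes the first letter, and a kept one is
    absorbed into [x]; [u] lives on [nat] so that it can be shifted. *)
Lemma crossing_exists k x (u : nat -> 'I_r) (f : pred nat) :
  len (\prod_(0 <= j < k) s (u j))%g = k ->
  (forall n, (n < k)%N -> f n ->
    (len (x * subword u f n * s (u n))%g < len (x * subword u f n)%g)%N) ->
  exists2 Q, size Q = count f (iota 0 k) &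
    crossing_inversions x (\prod_(0 <= j < k) s (u j))%g Q.
Proof.
elim: k x u f => [|k IH] x u f lenE fold.
  by exists [::] => //; split.
move: lenE; rewrite big_nat_recl //; set y := (\prod_(0 <= j < k) _)%g => lenE.
have leny : len y = k.
  apply/eqP; rewrite eqn_leq -[X in _ && X]ltnS -lenE (cox_lengthMl cox) andbT.
  have := cox_length_word s (map (u \o succn) (index_iota 0 k)).
  by rewrite big_map size_map size_iota subn0.
have yi : (len y < len (s (u 0%N) * y)%g)%N by rewrite leny lenE.
have subE n : subword u f n.+1 =
    ((if f 0%N then 1 else s (u 0%N)) * subword (u \o succn) (f \o succn) n)%g.
  rewrite big_mkcond big_nat_recl // [in RHS]big_mkcond /=.
  by case: (f 0%N).
have cntE : count f (iota 0 k.+1) = (f 0%N + count (f \o succn) (iota 0 k))%N.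
  by rewrite /= (iotaDl 1 0) count_map.
case f0: (f 0%N) cntE subE => cntE subE.
  have [|n nk fn|Q sizeQ cQ] := IH x (u \o succn) (f \o succn) => //.
    by have := fold n.+1 nk fn; rewrite subE mul1g.
  have xi : (len (x * s (u 0%N))%g < len x)%N.
    by have := fold 0%N isT f0; rewrite big_geq // mulg1.
  have [Q' sizeQ' cQ'] := crossing_fold xi yi cQ.
  by exists Q' => //; rewrite sizeQ' sizeQ cntE.
have [|n nk fn|Q sizeQ cQ] := IH (x * s (u 0%N))%g (u \o succn) (f \o succn) => //.
  by have := fold n.+1 nk fn; rewrite subE mulgA.
exists (map (act (s (u 0%N))) Q); first by rewrite size_map sizeQ cntE.
exact: crossing_cross.
Qed.

End Folding.

(** * The Tits cone: convexity, interior points and crossing hyperplanes *)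

Section TitsCone.
Local Open Scope classical_set_scope.
Variables (R : realType) (W : groupType) (r : nat) (s : 'I_r -> W).
Hypothesis cox : coxeter_system s.

Local Notation len := (cox_length s).
Local Notation "''a_' i" := (simple_root R i)
  (at level 8, i at level 2, format "''a_' i").
Local Notation B := (cox_form s).
Local Notation act := (actV cox).
Local Notation ht := (@height R r).
Local Notation root := (@Defs.roots R W r s cox).
Local Notation dual := (actVdual cox).
Local Notation U := (@tits_cone R W r s cox).
Implicit Types (f g : 'rV[R]_r) (b c : 'cV[R]_r) (w : W) (i : 'I_r).

Lemma pairingE f b : pairing f b = \sum_i f 0 i * b i 0.
Proof. by rewrite /pairing mxE. Qed.

Lemma pairingD f g b : pairing (f + g) b = pairing f b + pairing g b.
Proof. by rewrite /pairing mulmxDl mxE. Qed.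

Lemma pairingZ (t : R) f b : pairing (t *: f) b = t * pairing f b.
Proof. by rewrite /pairing -scalemxAl mxE. Qed.

Lemma pairingN f b : pairing f (- b) = - pairing f b.
Proof. by rewrite /pairing mulmxN mxE. Qed.

Lemma pairing_simple f i : pairing f 'a_i = f 0 i.
Proof. by rewrite /pairing -colE mxE. Qed.

Lemma pairing_const1 b : pairing (const_mx 1) b = ht b.
Proof. by rewrite pairingE; apply: eq_bigr => i _; rewrite mxE mul1r. Qed.

Lemma pairing_continuous b : continuous (fun f => pairing f b).
Proof.
have -> : (fun f => pairing f b) = fun f => \sum_i f 0 i * b i 0.
  by apply/funext => f; rewrite pairingE.
apply: (@continuous_big R _ +%R 0 xpredT) => [|i _ f].
  exact: pseudometric_normed_Zmodule.add_continuous.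
exact: (cvgM (@coord_continuous R 1 r 0 i f) (cvg_cst _)).
Qed.

Lemma dualM w1 w2 f : dual (w1 * w2)%g f = dual w1 (dual w2 f).
Proof. by rewrite /actVdual invgM geom_repM mulmxA. Qed.

Lemma dual1 f : dual 1%g f = f.
Proof. by rewrite /actVdual invg1 geom_rep1 mulmx1. Qed.

Lemma dualK w f : dual w^-1%g (dual w f) = f.
Proof. by rewrite -dualM mulVg dual1. Qed.

Lemma dualD w f g : dual w (f + g) = dual w f + dual w g.
Proof. exact: mulmxDl. Qed.

Lemma dualZ w (t : R) f : dual w (t *: f) = t *: dual w f.
Proof. by rewrite /actVdual scalemxAl. Qed.

Lemma pairing_dual w f b : pairing (dual w f) b = pairing f (act w^-1%g b).
Proof. by rewrite -(pairing_act cox w^-1%g) dualK. Qed.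

Lemma closure_chamberP f :
  closure (@chamber R r) f <-> forall i, 0 <= pairing f 'a_i.
Proof.
split=> [fC i|f0 N /nbhs_ballP[e /= e0 feN]].
  rewrite leNgt; apply/negP => fi.
  have near_lt : \forall g \near f, pairing g 'a_i < 0.
    exact: (cvgr_lt _ (@pairing_continuous 'a_i f)).
  have [g [/(_ i) gi gi']] := fC _ near_lt.
  by rewrite /= (lt_gtF gi) in gi'.
(* A small positive constant added to every coordinate moves [f] into the open chamber. *)
exists (f + const_mx (e / 2)); split=> [i|].
  rewrite pairingD [pairing (const_mx _) _]pairing_simple mxE.
  by rewrite ltr_wpDl ?divr_gt0.
apply: feN; split=> // i j; rewrite !mxE /ball /= opprD addNKr normrN.
by rewrite gtr0_norm ?divr_gt0 // gtr_pMr // invf_lt1 // ltr1n.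
Qed.

Lemma closure_chamber_pairing_ge0 f b : closure (@chamber R r) f ->
  root b -> 0 < ht b -> 0 <= pairing f b.
Proof.
move=> /closure_chamberP f0 rb hb; rewrite pairingE sumr_ge0 // => i _.
have [[_ b0]|[/lt_gtF]] := root_sign rb; last by rewrite hb.
by rewrite mulr_ge0 // -pairing_simple.
Qed.

Lemma tits_cone_dual w f : U (dual w f) <-> U f.
Proof.
suff H v g : U g -> U (dual v g).
  by split=> [/(H w^-1%g)|/H//]; rewrite dualK.
by move=> [x _ [h hC <-]]; exists (v * x)%g => //; exists h; rewrite ?dualM.
Qed.

(** Descent on [w]: if [f] is negative on ['a_i], then [s i] shortens [w], and [dual (s i) f]
    satisfies the hypothesis for [w * s i]. *)
Lemma tits_cone_inversions w f :
  (forall b, root b -> 0 < ht b -> pairing f b < 0 -> ht (act w b) < 0) -> U f.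
Proof.
have [n] := ubnP (len w); elim: n w f => // n IH w f; rewrite ltnS => wn fw.
have [fC|] := pselect (closure (@chamber R r) f).
  by exists 1%g => //; exists f; rewrite ?dual1.
move=> /closure_chamberP/existsNP[i /negP]; rewrite -ltNge => fi.
have wi : (len (w * s i)%g < len w)%N.
  rewrite -(act_simple_ht R cox w i).2; apply: fw => //; first exact: root_simple.
  by rewrite simple_ht.
apply/(tits_cone_dual (s i))/(IH (w * s i)%g) => [|b rb hb]; first by lia.
rewrite pairing_dual (cox_inv cox) actM => fb; apply: fw => //.
  exact: root_act.
rewrite -[_ < _]negbK -(root_ht_lt0 (root_act _ rb)); apply/negP => sb.
move: fb; rewrite (act_gen_ht_lt0 rb hb sb) act_gen_simple pairingN oppr_lt0.
by rewrite lt_gtF.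
Qed.

(** With [f] moved into the closed chamber, a positive root negative on the sum is negative on the
    other summand, hence inverted by one fixed element. *)
Lemma tits_coneD f g : U f -> U g -> U (f + g).
Proof.
move=> [v _ [f' f'C <-]] [w _ [g' g'C <-]].
apply/(tits_cone_dual v^-1%g); rewrite dualD dualK -dualM.
apply: (@tits_cone_inversions (v^-1 * w)^-1%g) => b rb hb.
rewrite pairingD pairing_dual => neg.
have f'b := closure_chamber_pairing_ge0 f'C rb hb.
rewrite (root_ht_lt0 (root_act _ rb)); apply/negP => wb.
have := closure_chamber_pairing_ge0 g'C (root_act _ rb) wb; lra.
Qed.

Lemma tits_coneZ (t : R) f : 0 <= t -> U f -> U (t *: f).
Proof.
move=> t0 [w _ [g /closure_chamberP g0 <-]]; rewrite -dualZ.
apply/tits_cone_dual; exists 1%g => //; exists (t *: g); last by rewrite dual1.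
by apply/closure_chamberP => i; rewrite pairingZ mulr_ge0.
Qed.

(** A point of the chamber [w^-1 C], chosen so that its value on a root [b] is the height of
    [act w b]. *)
Definition chamber_point w : 'rV[R]_r := dual w^-1%g (const_mx 1).

Lemma pairing_chamber_point w b : pairing (chamber_point w) b = ht (act w b).
Proof. by rewrite pairing_dual invgK pairing_const1. Qed.

Lemma tits_cone_chamber w f : (forall i, 0 < pairing (dual w f) 'a_i) -> U f.
Proof.
move=> fw; apply/(tits_cone_dual w); exists 1%g => //.
by exists (dual w f); rewrite ?dual1 //; apply/closure_chamberP => i; exact/ltW.
Qed.

Lemma tits_cone_chamber_point w : U (chamber_point w).
Proof.
apply: (@tits_cone_chamber w) => i.
by rewrite -[w in dual w]invgK dualK pairing_const1 simple_ht.
Qed.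

(** For [g] near the point, [g - f] stays in the open chamber of [chamber_point w], so [g] lies in
    [U] by convexity. *)
Lemma tits_cone_interior w (t : R) f : 0 < t -> U f ->
  interior U (t *: chamber_point w + f).
Proof.
move=> t0 Uf; set p := _ + f.
pose v i : 'cV[R]_r := act w^-1%g 'a_i.
have near_gt i : \forall g \near p, pairing f (v i) < pairing g (v i).
  apply: (cvgr_gt _ (@pairing_continuous (v i) p)).
  rewrite /p pairingD pairingZ pairing_chamber_point /v actKV simple_ht mulr1.
  by rewrite ltrDr.
apply: filterS (filter_forall _ near_gt) => g gf.
rewrite -(subrK f g); apply: tits_coneD => //.
apply: (@tits_cone_chamber w) => i.
by rewrite pairing_dual pairingD -scaleN1r pairingZ mulN1r subr_gt0 gf.
Qed.

Lemma hyperplane_interior b : root b ->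
  hyperplane b `&` interior U !=set0.
Proof.
move=> rb.
have [v [w [vb wb]]] : exists v w, 0 < ht (act v b) /\ ht (act w b) < 0.
  have [t tE] := root_reflection rb.
  have tb : act t b = - b.
    by rewrite tE root_form // mulr1 scaler_nat mulr2n opprD addNKr.
  case: (root_sign rb) => -[hb _].
    by exists 1%g, t; rewrite act1 tb heightN oppr_lt0.
  by exists t, 1%g; rewrite act1 tb heightN oppr_gt0.
(* The weights cancel the values of [b] at two points on opposite sides. *)
exists (- ht (act w b) *: chamber_point v + ht (act v b) *: chamber_point w).
split; last first.
  apply: tits_cone_interior; first by rewrite oppr_gt0.
  by apply: tits_coneZ; [exact: ltW|exact: tits_cone_chamber_point].
by rewrite /hyperplane /= pairingD !pairingZ !pairing_chamber_point; ring.
Qed.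

Section Crossing.
Variables b c : 'cV[R]_r.
Hypotheses (rb : root b) (rc : root c) (bc : -1 < B b c < 1).

(** An empty quadrant would be a nesting between signed copies of [b] and [c], hence a form of at
    least 1. *)
Lemma root_quadrants :
  [/\ exists w, 0 < ht (act w b) /\ 0 < ht (act w c),
      exists w, 0 < ht (act w b) /\ ht (act w c) < 0,
      exists w, ht (act w b) < 0 /\ 0 < ht (act w c)
    & exists w, ht (act w b) < 0 /\ ht (act w c) < 0].
Proof.
have /andP[bc_gt bc_lt] := bc.
have quadrant b' c' : root b' -> root c' -> B b' c' < 1 ->
    exists w, ht (act w b') < 0 /\ 0 < ht (act w c').
  move=> rb' rc' bc'; apply: contrapT => none.
  suff /(nested_form_ge1 rb' rc') : nested cox b' c' by rewrite leNgt bc'.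
  move=> w wb; rewrite (root_ht_lt0 (root_act _ rc')); apply/negP => wc.
  by apply: none; exists w.
have rNb := root_opp rb; have rNc := root_opp rc.
have NbE w : ht (act w (- b)) = - ht (act w b) by rewrite actN heightN.
have NcE w : ht (act w (- c)) = - ht (act w c) by rewrite actN heightN.
split.
- have [|w] := quadrant (- b) c rNb rc; first by rewrite (cox_formNl cox); lra.
  by rewrite NbE oppr_lt0; exists w.
- have [|w] := quadrant (- b) (- c) rNb rNc.
    by rewrite (cox_formNl cox) cox_formN; lra.
  by rewrite NbE NcE oppr_lt0 oppr_gt0; exists w.
- by apply: quadrant => //; lra.
- have [|w] := quadrant b (- c) rb rNc; first by rewrite cox_formN; lra.
  by rewrite NcE oppr_gt0; exists w.
Qed.

Lemma hyperplane_neq : hyperplane b <> hyperplane c.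
Proof.
have [[v [vb vc]] [w [wb wc]] _ _] := root_quadrants.
(* Both points are on the positive side of [b], and the weights cancel [c]. *)
pose f := - ht (act w c) *: chamber_point v + ht (act v c) *: chamber_point w.
move/seteqP => -[_ /(_ f)]; rewrite /hyperplane /= /f !pairingD !pairingZ.
rewrite !pairing_chamber_point => H.
have /H : - ht (act w c) * ht (act v c) + ht (act v c) * ht (act w c) = 0 by ring.
have : 0 < - ht (act w c) * ht (act v b) by rewrite mulr_gt0 ?oppr_gt0.
have : 0 < ht (act v c) * ht (act w b) by rewrite mulr_gt0.
lra.
Qed.

Lemma hyperplane_crossing :
  hyperplane b `&` hyperplane c `&` interior U !=set0.
Proof.
have [[w1 [b1 c1]] [w2 [b2 c2]] [w3 [b3 c3]] [w4 [b4 c4]]] := root_quadrants.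
set x1 := ht (act w1 b) in b1; set y1 := ht (act w1 c) in c1.
set x2 := ht (act w2 b) in b2; set y2 := ht (act w2 c) in c2.
set x3 := ht (act w3 b) in b3; set y3 := ht (act w3 c) in c3.
set x4 := ht (act w4 b) in b4; set y4 := ht (act w4 c) in c4.
(* The segments from chamber 1 to 2 and from chamber 3 to 4 meet the hyperplane
   of c on either side of the hyperplane of b. *)
pose p := x1 * - y2 + x2 * y1.
pose q := x3 * - y4 + x4 * y3.
have p0 : 0 < p by rewrite addr_gt0 // mulr_gt0 ?oppr_gt0.
have q0 : q < 0 
  by rewrite -oppr_gt0 opprD addr_gt0 // oppr_gt0 nmulr_rlt0 // oppr_gt0.
(* [p] and [q] are the values of [b] at the two points; weights [- q] and [p] cancel them. *)
exists ((- q * - y2) *: chamber_point w1 + ((- q * y1) *: chamber_point w2 +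
  ((p * - y4) *: chamber_point w3 + (p * y3) *: chamber_point w4))).
split; last first.
  apply: tits_cone_interior; first by rewrite mulr_gt0 ?oppr_gt0.
  have cp w (t : R) : 0 <= t -> U (t *: chamber_point w).
    by move=> t0; apply: tits_coneZ => //; exact: tits_cone_chamber_point.
  by apply: tits_coneD; [|apply: tits_coneD]; apply: cp;
    rewrite mulr_ge0 ?oppr_ge0 ?ltW // oppr_gt0.
split; rewrite /hyperplane /= !pairingD !pairingZ !pairing_chamber_point.
  by rewrite -/x1 -/x2 -/x3 -/x4 /p /q; ring.
by rewrite -/y1 -/y2 -/y3 -/y4; ring.
Qed.

End Crossing.
End TitsCone.

(* From roots to hyperplanes, and the theorem *)
Local Close Scope ring_scope.
Local Open Scope classical_set_scope.
Local Open Scope group_scope.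

Lemma crossing_intersecting (R : realType) (W : groupType) (r : nat)
    (s : 'I_r -> W) (cox : coxeter_system s) (x y : W) (L : seq 'cV[R]_r) :
  crossing_inversions cox x y L ->
  exists Q : set (set 'rV[R]_r), intersecting cox Q /\ (Q #= `I_(size L))%card.
Proof.
move=> [Luniq Linv LB].
have Lroot b : b \in L -> Defs.roots cox b by case/Linv => -[].
have Lcross b c : b \in L -> c \in L -> b != c -> (-1 < cox_form s b c < 1)%R.
  move=> bL cL bc; rewrite LB // andbT.
  have [[rb hb xb] _] := Linv b bL; have [[rc hc xc] _] := Linv c cL.
  exact: (inversions_form_gt rb rc hb hc xb xc).
pose H n := hyperplane (nth 0%R L n).
have HL n : (n < size L)%N -> nth 0%R L n \in L by exact: mem_nth.
exists (H @` `I_(size L)); split; last first.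
  apply: inj_card_eq => m n; rewrite !inE /= => mL nL Hmn; apply/eqP.
  rewrite -(nth_uniq 0%R mL nL Luniq); apply: contraPT Hmn => ne.
  exact: hyperplane_neq (Lroot _ (HL m mL)) (Lroot _ (HL n nL))
    (Lcross _ _ (HL m mL) (HL n nL) ne).
split=> [_ [n /= nL <-]|_ _ [m /= mL <-] [n /= nL <-]].
  exists (nth 0%R L n) => //; have rb := Lroot _ (HL n nL); split=> //.
  exists (fun j => nth 0%R L n j 0%R) => [j|].
    have [[_ hb _] _] := Linv _ (HL n nL).
    by have [[_ b0]|[/lt_gtF]] := root_sign rb; rewrite ?hb.
  apply/matrixP => j l; rewrite ord1 summxE (bigD1 j) //= big1 ?addr0 => [|q qj].
    by rewrite !mxE !eqxx mulr1.
  by rewrite !mxE eq_sym (negbTE qj) mulr0.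
(* The pair may consist of one hyperplane twice, which must then meet the interior itself. *)
rewrite /H; have [<-|ne] := eqVneq (nth 0%R L m) (nth 0%R L n).
  by have [f [Hf Uf]] := hyperplane_interior (Lroot _ (HL m mL)); exists f.
exact: hyperplane_crossing (Lroot _ (HL m mL)) (Lroot _ (HL n nL))
  (Lcross _ _ (HL m mL) (HL n nL) ne).
Qed.

Theorem theorem1p4 (R : realType) (W : groupType) (r : nat) (s : 'I_r -> W)
    (cox : coxeter_system s) (x y : W) (k : nat) (u : 'I_k -> 'I_r)
    (hy : reduced_expression s u y) (p : nat) (i : 'I_p -> 'I_k)
    (hi : forall a b : 'I_p, (a < b)%N -> (i a < i b)%N)
    (hlt : forall n : 'I_p,
      let v := x * \prod_(j < k | (j < i n)%N &&
                           ~~ [exists m : 'I_p, (m < n)%N && (i m == j)])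
                     s (u j) in
      bruhat_lt s (v * s (u (i n))) v) :
  exists Q : set (set 'rV[R]_r), intersecting cox Q /\ (Q #= `I_p)%card.
Proof.
(* [inord] needs a nonempty index type; for the empty word, [p] is 0. *)
case: k u hy i hi hlt => [|k] u [yE ky] i hi hlt.
  case: p i hi hlt => [|p] i _ _; last by case: (i ord0).
  by apply: (@crossing_intersecting R W r s cox x y [::]); split.
pose un j := u (inord j).
pose f j := [exists m : 'I_p, i m == j :> nat].
have i_inj : injective (val \o i).
  by move=> a b /= ab; apply/val_inj; case: (ltngtP a b) => // /hi; rewrite ab ltnn.
have cnt : count f (iota 0 k.+1) = p.
  rewrite -size_filter -[RHS]size_enum_ord -(size_map (val \o i)).
  apply/perm_size/uniq_perm => [||j].
  - by rewrite filter_uniq ?iota_uniq.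
  - by rewrite map_inj_uniq ?enum_uniq.
  rewrite mem_filter mem_iota add0n /=; apply/andP/mapP.
    by move=> [/existsP[m /eqP <-] _]; exists m; rewrite ?mem_enum.
  by move=> [m _ ->]; split; [apply/existsP; exists m|exact: ltn_ord].
have yE' : (\prod_(0 <= j < k.+1) s (un j))%g = y.
  by rewrite big_mkord yE; apply: eq_bigr => j _; rewrite /un inord_val.
have [|n nk /existsP[a /eqP ian]|Q sizeQ cQ] :=
    @crossing_exists R W r s cox k.+1 x un f.
- by rewrite yE'.
- rewrite -ian; apply: bruhat_lt_length.
  have -> : (\prod_(0 <= j < i a | ~~ f j) s (un j))%g =
      \prod_(j < k.+1 | (j < i a)%N &&
        ~~ [exists m : 'I_p, (m < a)%N && (i m == j)]) s (u j).
    rewrite big_mkord; have ik : (i a <= k.+1)%N by exact: ltnW.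
    rewrite (big_ord_widen_cond k.+1 (fun j => ~~ f j) (fun j => s (un j)) ik).
    apply: eq_big => [j|j _]; last by rewrite /un inord_val.
    (* As [i] is increasing, the omitted positions below [i a] are the [i m] with [m < a]. *)
    rewrite andbC; case: ltnP => //= ja; congr (~~ _).
    apply/existsP/existsP => -[m]; last by move=> /andP[_ /eqP <-]; exists m.
    move=> /eqP mj; exists m; rewrite -val_eqE /= mj eqxx andbT.
    by case: (ltngtP m a) => // [/hi|/val_inj ma]; move: ja; rewrite -mj ?ma; lia.
  by have := hlt a; rewrite /un inord_val.
by rewrite -[p in `I_p]cnt -sizeQ; exact: crossing_intersecting cQ.
Qed.
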